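(* Let $T>0$, $t_0\in(0,T)$, $\alpha>0$, $u_0\in\mathbb R$, and let $g(t)=t$ for $0\le t\le t_0$, $g(t)=t+\alpha$ for $t_0<t\le T$. Set $$x_-:=\frac{u_0}{\sqrt{1+2t_0u_0^2}},\qquad x_+:=x_--\alpha x_-^3 .$$ Then the unique integral and weak solution of $D_gU=-U^3$, $U(0)=u_0$, is $$U(t)=\begin{cases}\dfrac{u_0}{\sqrt{1+2tu_0^2}},&0\le t\le t_0,\\[3mm]\dfrac{x_+}{\sqrt{1+2(t-t_0)x_+^2}},&t_0<t\le T.\end{cases}$$ That is, this $U$ is the unique integral solution, and the corresponding state $([U],u_0,U(T))$ is the unique global weak solution with initial trace $u_0$.
   Context: The Lebesgue--Stieltjes measure of $g$ on $[0,T)$, characterized by $\mu_g([s,t))=g(t)-g(s)$, is $\mu_g=dt+\alpha\delta_{t_0}$. $L_g^p=L_g^p([0,T))$ is the $L^p$ space for the completion of $\mu_g$. $AC_g([0,T])$ is the set of $u:[0,T]\to\mathbb R$ such that for every $\varepsilon>0$ there is $\delta>0$ such that, for every finite family of pairwise disjoint intervals $[a_j,b_j)\subset[0,T)$, $\sum_j(g(b_j)-g(a_j))<\delta$ implies $\sum_j|u(b_j)-u(a_j)|<\varepsilon$. Equivalently (known), $u(t)=u(0)+\int_{[0,t)}v\,d\mu_g$ for all $t\in[0,T]$ with some $v\in L_g^1$, unique $\mu_g$-a.e. and denoted $D_gu$. Integral solution: $U\in AC_g([0,T])$ with $U(t)=u_0-\int_{[0,t)}U(s)^3\,d\mu_g(s)$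 for all $t\in[0,T]$. Global weak solution with initial trace $u_0$: a state $([u],u_0,u_T)$ with $u\in L_g^1([0,T))$, $u_T\in\mathbb R$, $u^3\in L_g^1$, and $$\int_{[0,T)}u\,D_g\varphi\,d\mu_g-\int_{[0,T)}u^3\,S_g\varphi\,d\mu_g=u_T\varphi(T)-u_0\varphi(0)$$ for every $\varphi$ of the form $\varphi(t)=c+\int_{[0,t)}\psi\,d\mu_g$ with $c\in\mathbb R$, $\psi\in L_g^\infty$ (so $D_g\varphi=\psi$), where $S_g\varphi(t_0)=\varphi(t_0^+)$ and $S_g\varphi(t)=\varphi(t)$ for $t\ne t_0$. *)

(* Defs.v *)
From HB Require Import structures.
From mathcomp Require Import all_boot all_order all_algebra.
From mathcomp Require Import all_classical all_reals all_analysis.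
From mathcomp Require Import lra.

Set Implicit Arguments.
Unset Strict Implicit.
Unset Printing Implicit Defensive.

Import Order.TTheory GRing.Theory Num.Theory.
Import numFieldNormedType.Exports.

Local Open Scope classical_set_scope.
Local Open Scope ring_scope.

(* Functions on [0, T] or [0, T) are represented by functions on R of which only
   the values on that interval are ever used. *)

Definition derivator (R : realType) (t0 : R) (alpha : {posnum R}) (t : R) : R :=
  if t <= t0 then t else t + alpha%:num.

(* dt + alpha delta_{t0} on the Borel sets *)
Definition borel_mu (R : realType) (t0 : R) (alpha : {posnum R}) :
    {measure set (measurableTypeR R) -> \bar R} :=
  measure_add (@lebesgue_measure R)
    (mscale alpha%:num%:nng (@dirac _ (measurableTypeR R) t0 R)).

(* Completion of [borel_mu]: its Caratheodory extension, which for a sigma-finite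
   measure is its completion. *)
Definition mu_g (R : realType) (t0 : R) (alpha : {posnum R}) :=
  @completed_measure_extension _ _ _ (borel_mu t0 alpha).
Arguments mu_g {R} t0 alpha.

HB.instance Definition _ (R : realType) (t0 : R) (alpha : {posnum R}) :=
  Measure.on (@mu_g R t0 alpha).

(* [mu_g] is the Lebesgue-Stieltjes measure of [derivator] *)
Lemma mu_g_itv (R : realType) (t0 : R) (alpha : {posnum R}) (s t : R) :
  s <= t ->
  mu_g t0 alpha `[s, t[ = (derivator t0 alpha t - derivator t0 alpha s)%:E.
Proof.
move=> st; rewrite /mu_g /completed_measure_extension measurable_mu_extE;
    last first.
  exact: measurable_itv.
rewrite [LHS]measure_addE.
have jumpE : mscale alpha%:num%:nng (@dirac _ (measurableTypeR R) t0 R)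
      `[s, t[%classic =
    (alpha%:num * ((s <= t0) && (t0 < t))%:R)%:E.
  rewrite /mscale EFinM; congr (_ * _)%E.
  by rewrite [LHS]diracE mem_setE in_itv.
rewrite [X in (_ + X)%E]jumpE.
rewrite [X in (X + _)%E](lebesgue_measure_itv `[s, t[)/= lte_fin /derivator.
move: st; rewrite le_eqVlt => /predU1P[<-|st].
  by rewrite ltxx subrr add0e leNgt andNb mulr0.
rewrite st; have [st0|st0] := leP s t0; have [tt0|tt0] := leP t t0 => //=.
- by rewrite mulr0 adde0 EFinB.
- by rewrite mulr1 -EFinB -EFinD; congr EFin; lra.
- by move: (lt_le_trans st tt0) => /lt_trans/(_ st0); rewrite ltxx.
- by rewrite mulr0 adde0 -EFinB; congr EFin; lra.
Qed.

Lemma mu_g_complete (R : realType) (t0 : R) (alpha : {posnum R}) :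
  measure_is_complete (mu_g t0 alpha).
Proof. exact: measure_is_complete_caratheodory. Qed.

(* Extension by zero outside [0, T) (the default [point] of [\_] is 0 in R)
   replaces restriction of the measure. *)
Definition in_Lg (R : realType) (T t0 : R) (alpha : {posnum R}) (p : \bar R)
    (u : R -> R) : Prop :=
  (u \_ `[0, T[) \in Lfun (mu_g t0 alpha) p.

Definition in_ACg (R : realType) (T t0 : R) (alpha : {posnum R})
    (u : R -> R) : Prop :=
  forall eps : R, 0 < eps -> exists2 delta : R, 0 < delta &
    forall (n : nat) (a b : 'I_n -> R),
      (forall j, a j < b j) ->
      (forall j, `[a j, b j[ `<=` `[0, T[) ->
      trivIset setT (fun j => `[a j, b j[%classic) ->
      \sum_(j < n) (derivator t0 alpha (b j) - derivator t0 alpha (a j)) < delta ->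
      \sum_(j < n) `|u (b j) - u (a j)| < eps.

(* The integrability of U^3 is automatic for U in AC_g; it is recorded because
   [Rintegral] is a total operator. *)
Definition integral_solution (R : realType) (T t0 : R) (alpha : {posnum R})
    (u0 : R) (U : R -> R) : Prop :=
  [/\ in_ACg T t0 alpha U,
      in_Lg T t0 alpha 1 (fun s => U s ^+ 3) &
      forall t, t \in `[0, T] ->
        U t = u0 - \int[mu_g t0 alpha]_(s in `[0, t[) (U s ^+ 3)].

Definition test_fun (R : realType) (t0 : R) (alpha : {posnum R}) (c : R)
    (psi : R -> R) (t : R) : R :=
  c + \int[mu_g t0 alpha]_(s in `[0, t[) psi s.

Definition Sg (R : realType) (t0 : R) (phi : R -> R) (t : R) : R :=
  if t == t0 then lim (phi x @[x --> t0^'+]) else phi t.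

(* [weak_solution T t0 alpha u0 u uT]: the state ([u], u0, uT) is a global weak
   solution with initial trace u0. *)
Definition weak_solution (R : realType) (T t0 : R) (alpha : {posnum R})
    (u0 : R) (u : R -> R) (uT : R) : Prop :=
  [/\ in_Lg T t0 alpha 1 u,
      in_Lg T t0 alpha 1 (fun s => u s ^+ 3) &
      forall (c : R) (psi : R -> R), in_Lg T t0 alpha +oo%E psi ->
        let phi := test_fun t0 alpha c psi in
        \int[mu_g t0 alpha]_(s in `[0, T[) (u s * psi s)
        - \int[mu_g t0 alpha]_(s in `[0, T[) (u s ^+ 3 * Sg t0 phi s)
        = uT * phi T - u0 * phi 0].

Definition xminus (R : realType) (t0 u0 : R) : R :=
  u0 / Num.sqrt (1 + 2 * t0 * u0 ^+ 2).

Definition xplus (R : realType) (t0 : R) (alpha : {posnum R}) (u0 : R) : R :=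
  xminus t0 u0 - alpha%:num * xminus t0 u0 ^+ 3.

Definition explicit_solution (R : realType) (t0 : R) (alpha : {posnum R})
    (u0 t : R) : R :=
  if t <= t0 then u0 / Num.sqrt (1 + 2 * t * u0 ^+ 2)
  else xplus t0 alpha u0 /
       Num.sqrt (1 + 2 * (t - t0) * xplus t0 alpha u0 ^+ 2).

(* Main.v *)
(** The measure of [a, b) minus the point t0 is b - a, so every integral is
controlled by the length of the interval once the atom at t0 is split off.
A function whose increments are bounded by K (t - s) (N t - N s) is constant, as
one sees by summing over finer and finer uniform partitions.  Applied on [0, t0]
and on [t0, T], this replaces both the fundamental theorem of calculus (for the
explicit solution) and Fubini's theorem (for the integration by parts
V(T) phi(T) - V(0) phi(0) = int V D phi - int f S phi, where D V = -f).
Two integral solutions agree by a contraction argument on short steps, the atom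
only ever sitting at the left end of a step, where they already agree.  For a weak
solution v, put V(t) := u0 - int_{[0,t)} v^3; subtracting the integration by parts
for V from the weak identity leaves int (v - V) psi = (vT - V(T)) phi(T), whence
vT = V(T) (psi = 0) and v = V almost everywhere (psi = the sign of v - V), so that
V is an integral solution. *)
Require Import Defs.
From mathcomp Require Import all_boot all_order all_algebra.
From mathcomp Require Import all_classical all_reals all_analysis.
From mathcomp Require Import measurable_realfun ess_sup_inf ring lra.

Set Implicit Arguments.
Unset Strict Implicit.
Unset Printing Implicit Defensive.

Import Order.TTheory GRing.Theory Num.Theory.
Import numFieldNormedType.Exports.

Local Open Scope classical_set_scope.
Local Open Scope ring_scope.

(** * Constancy from increment bounds, and deletion of null sets *)

Lemma squeeze_geometric (R : realType) (x C : R) :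
  (forall n : nat, x <= C / n.+1%:R) -> x <= 0.
Proof.
move=> xC; rewrite leNgt; apply/negP => x0.
have C0 : 0 < C by have := xC 0%N; rewrite divr1; apply: lt_le_trans.
have /archi_boundP := divr_ge0 (ltW C0) (ltW x0).
set n := Num.bound _ => Cn.
have := xC n; rewrite ler_pdivlMr//.
move: Cn; rewrite ltr_pdivrMr// => Cn.
have : x * n.+1%:R = n%:R * x + x by rewrite -natr1; ring.
lra.
Qed.

(* Summing over the uniform partition into n pieces bounds
   [F b - F a] by [K * (b - a) / n * (N b - N a)]. *)
Lemma eq_of_increment_bound (R : realType) (F N : R -> R) (K a b : R) :
  a <= b ->
  (forall s t, a <= s -> s <= t -> t <= b ->
    `|F t - F s| <= K * (t - s) * (N t - N s)) ->
  F b = F a.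
Proof.
move=> ab incr; apply/eqP; rewrite -subr_eq0 -normr_le0.
apply: (@squeeze_geometric _ _ (K * (b - a) * (N b - N a))) => n.
set h := (b - a) / n.+1%:R.
have n0 : 0 < n.+1%:R :> R by [].
have h0 : 0 <= h by rewrite divr_ge0// subr_ge0.
have hn : h * n.+1%:R = b - a by rewrite divfK// gt_eqF.
have part k : (k <= n.+1)%N ->
    `|F (a + k%:R * h) - F a| <= K * h * (N (a + k%:R * h) - N a).
  elim: k => [_|k IH kn].
    by rewrite mul0r addr0 !subrr normr0 mulr0.
  have := IH (ltnW kn); set s := a + k%:R * h.
  have tE : a + k.+1%:R * h = s + h by rewrite /s -natr1; ring.
  rewrite tE => IHs.
  have as_ : a <= s by rewrite lerDl mulr_ge0.
  have sb : s + h <= b.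
    by rewrite -tE -lerBrDl -hn [leRHS]mulrC ler_wpM2r// ler_nat.
  have sh : s <= s + h by rewrite lerDl.
  have := incr _ _ as_ sh sb.
  rewrite (_ : s + h - s = h); last by ring.
  rewrite (_ : F (s + h) - F a = (F (s + h) - F s) + (F s - F a)); last by ring.
  move=> st; apply: (le_trans (ler_normD _ _)).
  apply: (le_trans (lerD st IHs)); rewrite -mulrDr le_eqVlt; apply/orP; left.
  by apply/eqP; congr (_ * _); ring.
have := part n.+1 (leqnn _).
rewrite mulrC hn (_ : a + (b - a) = b); last by ring.
by move=> /le_trans; apply; rewrite le_eqVlt /h; apply/orP; left; apply/eqP; ring.
Qed.

Lemma measureD_null d (T : measurableType d) (R : realType)
    (mu : {measure set T -> \bar R}) (A B : set T) :
  measurable A -> measurable B -> mu B = 0%E -> mu (A `\` B) = mu A.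
Proof.
move=> mA mB B0.
have AB0 : mu (A `&` B) = 0%E.
  apply/eqP; rewrite eq_le measure_ge0 andbT -B0.
  by apply: le_measure; rewrite ?inE//; exact: measurableI.
by rewrite -[LHS]adde0 -AB0; exact/esym/measureDI.
Qed.

(** * Values of [mu_g] on Borel sets and its atom at [t0] *)

Section atom.
Context (R : realType) (t0 : R) (alpha : {posnum R}).
Notation mu := (mu_g t0 alpha).
Notation carT := (caratheodory_type (mu_ext (borel_mu t0 alpha))).

Lemma borel_measurable_mu_g (A : set (measurableTypeR R)) :
  measurable A -> measurable (A : set carT).
Proof.
move=> mA; exact: caratheodory_measurable_mu_ext.
Qed.

Lemma mu_g_borel (A : set (measurableTypeR R)) : measurable A ->
  mu A = (lebesgue_measure A + (alpha%:num * \1_A t0)%:E)%E.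
Proof.
move=> mA; rewrite /mu_g /completed_measure_extension measurable_mu_extE//.
rewrite [LHS]measure_addE; congr (_ + _)%E.
Qed.

Lemma measurable_itv_mu_g (i : interval R) : measurable ([set` i] : set carT).
Proof. by apply: borel_measurable_mu_g; exact: measurable_itv. Qed.

Lemma measurable_set1_mu_g (x : R) : measurable ([set x] : set carT).
Proof. by apply: borel_measurable_mu_g; exact: measurable_set1. Qed.

Lemma mu_g_set1 : mu [set t0] = alpha%:num%:E.
Proof.
rewrite mu_g_borel; last exact: measurable_set1.
by rewrite lebesgue_measure_set1 add0e indicE mem_set// mulr1.
Qed.

(** The Dirac part vanishes off [t0], and deleting one point does not change Lebesgue measure. *)
Lemma mu_g_itvD (s t : R) : s <= t -> mu (`[s, t[ `\ t0) = (t - s)%:E.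
Proof.
move=> st; have mD : measurable (`[s, t[ `\ t0 : set (measurableTypeR R)).
  by apply: measurableD; [exact: measurable_itv|exact: measurable_set1].
rewrite mu_g_borel// indicE memNset ?mulr0 ?adde0; last by move=> [_]; exact.
have itvE := @lebesgue_measure_itv R (Interval (BLeft s) (BLeft t)).
have <- : @lebesgue_measure R `[s, t[%classic = (t - s)%:E.
  rewrite itvE/= lte_fin; move: st; rewrite le_eqVlt => /predU1P[->|->].
    by rewrite ltxx subrr.
  by rewrite EFinB.
apply: (@measureD_null _ (measurableTypeR R) R lebesgue_measure
  `[s, t[%classic [set t0]).
- exact: measurable_itv.
- exact: measurable_set1.
- exact: lebesgue_measure_set1.
Qed.

Lemma Rintegral_mu_g_set1 (f : R -> R) :
  \int[mu]_(s in [set t0]) f s = alpha%:num * f t0.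
Proof.
rewrite (@eq_Rintegral _ _ _ _ _ (cst (f t0))); last first.
  by move=> x; rewrite inE/= => ->.
rewrite (Rintegral_cst mu (measurable_set1_mu_g t0)) mulrC.
by congr (_ * _); exact: (congr1 fine mu_g_set1).
Qed.

End atom.

(** * Splitting integrals at the atom and along adjacent intervals *)

Section interval_additivity.
Context (R : realType) (t0 : R) (alpha : {posnum R}).
Notation mu := (mu_g t0 alpha).
Notation carT := (caratheodory_type (mu_ext (borel_mu t0 alpha))).

(** If [t0] lies outside [[a, b[], deleting it changes nothing and the correction is 0. The case
    [t0 = b] belongs there, as the interval is half open. *)
Lemma Rintegral_itvD_set1 (a b : R) (f : R -> R) :
  mu.-integrable `[a, b[ (EFin \o f) ->
  \int[mu]_(s in `[a, b[) f s = \int[mu]_(s in `[a, b[ `\ t0) f s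
    + (if a <= t0 < b then alpha%:num * f t0 else 0).
Proof.
move=> fi; case: ifPn => [t0ab|t0ab]; last first.
  rewrite addr0; congr (Rintegral _ _ _); apply/seteqP; split=> [x xab|x []//].
  split=> // xt0; move: xab t0ab; rewrite xt0 /= in_itv/= => ->.
  by [].
have t0ab' : [set t0] `<=` `[a, b[ by move=> _ ->; rewrite /= in_itv/= t0ab.
rewrite -[in LHS](setDUK t0ab') setUC Rintegral_setU.
- by congr (_ + _); exact: Rintegral_mu_g_set1.
- apply: measurableD; first exact: measurable_itv_mu_g.
  exact: measurable_set1_mu_g.
- exact: measurable_set1_mu_g.
- by rewrite setUC setDUK.
- by apply/disj_setPS => x [[]].
Qed.

Lemma Rintegral_itv_cat (a b c : R) (f : R -> R) : a <= b -> b <= c ->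
  mu.-integrable `[a, c[ (EFin \o f) ->
  \int[mu]_(s in `[a, c[) f s =
  \int[mu]_(s in `[a, b[) f s + \int[mu]_(s in `[b, c[) f s.
Proof.
move=> ab bc fi.
have acE : `[a, c[%classic = `[a, b[ `|` `[b, c[ :> set R.
  by rewrite -itv_bndbnd_setU.
rewrite acE Rintegral_setU//; first exact: measurable_itv_mu_g.
- exact: measurable_itv_mu_g.
- by move: fi; rewrite acE.
- apply/disj_setPS => x [/=]; rewrite !in_itv/= => /andP[_ xb] /andP[bx _].
  by move: (lt_le_trans xb bx); rewrite ltxx.
Qed.

Lemma Rintegral_itvD_cat (a b c : R) (f : R -> R) : a <= b -> b <= c ->
  mu.-integrable `[a, c[ (EFin \o f) ->
  \int[mu]_(s in `[a, c[ `\ t0) f s =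
  \int[mu]_(s in `[a, b[ `\ t0) f s + \int[mu]_(s in `[b, c[ `\ t0) f s.
Proof.
move=> ab bc fi.
have acE : `[a, c[ `\ t0 = (`[a, b[ `\ t0) `|` (`[b, c[ `\ t0) :> set R.
  by rewrite -setDUl -itv_bndbnd_setU.
have mD x y : measurable (`[x, y[ `\ t0 : set carT).
  apply: measurableD; first exact: measurable_itv_mu_g.
  exact: measurable_set1_mu_g.
rewrite acE Rintegral_setU//.
- rewrite -acE; apply: integrableS fi; [exact: measurable_itv_mu_g|exact: mD|].
  by move=> x [].
- apply/disj_setPS => x [[/=]]; rewrite !in_itv/= => /andP[_ xb] _ [/andP[bx _] _].
  by move: (lt_le_trans xb bx); rewrite ltxx.
Qed.

(** The bound is asked for only almost everywhere so that it serves the densities [psi] of test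
    functions, which are only essentially bounded. *)
Lemma Rintegral_bound (D : set carT) (f : R -> R) (K : R) : measurable D ->
  (mu D < +oo)%E -> mu.-integrable D (EFin \o f) -> 0 <= K ->
  {ae mu, forall s, D s -> `|f s| <= K} ->
  `|\int[mu]_(s in D) f s| <= K * fine (mu D).
Proof.
move=> mD Doo fi K0 fK; rewrite -lee_fin EFin_normr_Rintegral//.
have mf := measurable_int _ fi.
apply: (le_trans (le_abse_integral _ mD mf)).
rewrite EFinM fineK ?ge0_fin_numE//.
by apply: integral_le_bound => //; rewrite ?lee_fin//.
Qed.

End interval_additivity.

(** * Bounds on intervals, integrability, and measurability of primitives *)

Section interval_bounds.
Context (R : realType) (t0 : R) (alpha : {posnum R}).
Notation mu := (mu_g t0 alpha).
Notation carT := (caratheodory_type (mu_ext (borel_mu t0 alpha))).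

Lemma borel_measurable_fun (D : set (measurableTypeR R)) (f : R -> R) :
  measurable D -> measurable_fun D f -> measurable_fun (D : set carT) f.
Proof.
move=> mD mf _ Y mY; apply: borel_measurable_mu_g; exact: mf.
Qed.

Lemma integrable_subitv (a b a' b' : R) (f : R -> R) : a <= a' -> b' <= b ->
  mu.-integrable `[a, b[ (EFin \o f) -> mu.-integrable `[a', b'[ (EFin \o f).
Proof.
move=> aa' bb'; apply: integrableS; [exact: measurable_itv_mu_g..|].
by apply: subset_itv; rewrite bnd_simp.
Qed.

Lemma measurable_itvD_mu_g (a b : R) : measurable (`[a, b[ `\ t0 : set carT).
Proof.
apply: measurableD; first exact: measurable_itv_mu_g.
exact: measurable_set1_mu_g.
Qed.

Lemma integrable_itvD (a b : R) (f : R -> R) :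
  mu.-integrable `[a, b[ (EFin \o f) ->
  mu.-integrable (`[a, b[ `\ t0) (EFin \o f).
Proof.
apply: integrableS; [exact: measurable_itv_mu_g|exact: measurable_itvD_mu_g|].
by move=> x [].
Qed.

Lemma Rintegral_itvD_bound (a b K : R) (f : R -> R) : a <= b ->
  mu.-integrable `[a, b[ (EFin \o f) -> 0 <= K ->
  {ae mu, forall s, (`[a, b[ `\ t0) s -> `|f s| <= K} ->
  `|\int[mu]_(s in `[a, b[ `\ t0) f s| <= K * (b - a).
Proof.
move=> ab fi K0 fK.
have muE := mu_g_itvD t0 alpha ab.
apply: (le_trans (Rintegral_bound (measurable_itvD_mu_g a b) _ _ K0 fK)).
- by rewrite muE ltry.
- exact: integrable_itvD.
- by rewrite muE.
Qed.

Lemma Rintegral_itv_bound (a b K : R) (f : R -> R) : a <= b ->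
  mu.-integrable `[a, b[ (EFin \o f) -> 0 <= K ->
  {ae mu, forall s, s \in `[a, b[ -> `|f s| <= K} ->
  `|\int[mu]_(s in `[a, b[) f s| <=
    K * (derivator t0 alpha b - derivator t0 alpha a).
Proof.
move=> ab fi K0 fK.
have muE := mu_g_itv t0 alpha ab.
apply: (le_trans (Rintegral_bound (measurable_itv_mu_g t0 alpha _) _ fi K0 fK)).
- by rewrite muE ltry.
- by rewrite muE.
Qed.

Lemma mu_g_itv_lty (a b : R) : a <= b -> (mu `[a, b[ < +oo)%E.
Proof. by move=> ab; rewrite (mu_g_itv t0 alpha ab) ltry. Qed.

Lemma bounded_integrable_itv (a b K : R) (f : R -> R) : a <= b ->
  measurable_fun (`[a, b[ : set carT) f ->
  (forall s, s \in `[a, b[ -> `|f s| <= K) ->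
  mu.-integrable `[a, b[ (EFin \o f).
Proof.
move=> ab mf fK; apply: measurable_bounded_integrable => //.
- exact: measurable_itv_mu_g.
- exact: (mu_g_itv_lty ab).
- exists K; split; first exact: num_real.
  by move=> x Kx s sab; apply: (le_trans _ (ltW Kx)); apply: fK.
Qed.

Lemma integrable_mul_bounded (D : set carT) (K : R) (f h : R -> R) :
  measurable D -> measurable_fun D h ->
  (forall s, D s -> `|h s| <= K) ->
  mu.-integrable D (EFin \o f) ->
  mu.-integrable D (EFin \o (fun s => h s * f s)).
Proof.
move=> mD mh hK fi.
have -> : EFin \o (fun s => h s * f s) = ((EFin \o h) \* (EFin \o f))%E.
  by apply/funext => s; rewrite /= EFinM.
apply: integrableMr => //.
exists K; split; first exact: num_real.
by move=> x Kx s sab; apply: (le_trans _ (ltW Kx)); apply: hK.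
Qed.

(** The primitive of a nonnegative function is nondecreasing, hence Borel; the general case follows
    from [f = (|f| + f) - |f|]. *)
Lemma measurable_primitive (T : R) (f : R -> R) : 0 <= T ->
  mu.-integrable `[0, T[ (EFin \o f) ->
  measurable_fun (`[0, T[ : set carT) (fun t => \int[mu]_(s in `[0, t[) f s).
Proof.
move=> T0; have ge0_case (h : R -> R) : (forall s, 0 <= h s) ->
    mu.-integrable `[0, T[ (EFin \o h) ->
    measurable_fun (`[0, T[ : set carT) (fun t => \int[mu]_(s in `[0, t[) h s).
  move=> h0 hi.
  (* Clamping the endpoint to [[0, T]], where integrability is known, makes [G] nondecreasing on the
     whole line. *)
  pose c (t : R) := Num.max 0 (Num.min t T).
  pose G (t : R) := \int[mu]_(s in `[0, c t[) h s.
  have G_nd : nondecreasing_fun G.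
    move=> s t st; have cst : c s <= c t.
      by rewrite /c; apply: le_max2 => //; apply: le_min2.
    have c0 u : 0 <= c u by rewrite /c le_max lexx.
    have cT u : c u <= T by rewrite /c ge_max T0 ge_min lexx orbT.
    rewrite /G (Rintegral_itv_cat (c0 s) cst) ?lerDl; last first.
      exact: integrable_subitv hi.
    by apply: Rintegral_ge0 => x _; exact: h0.
  apply: (@eq_measurable_fun _ _ carT _ _ G).
    move=> t; rewrite inE/= in_itv/= => /andP[t_ge0 tT].
    by rewrite /G /c (min_idPl (ltW tT)) (max_idPr t_ge0).
  apply: borel_measurable_fun; first exact: measurable_itv.
  by apply: nondecreasing_measurable => //; exact: measurable_itv.
move=> fi.
have ni : mu.-integrable `[0, T[ (EFin \o (fun s => `|f s|)).
  exact: integrable_norm fi.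
have si : mu.-integrable `[0, T[ (EFin \o (fun s => `|f s| + f s)).
  exact: (integrableD (measurable_itv_mu_g t0 alpha _) ni fi).
apply: (@eq_measurable_fun _ _ carT _ _ (fun t =>
  \int[mu]_(s in `[0, t[) (`|f s| + f s) - \int[mu]_(s in `[0, t[) `|f s|)).
  move=> t; rewrite inE/= in_itv/= => /andP[t_ge0 tT].
  rewrite RintegralD.
  - by rewrite addrAC subrr add0r.
  - exact: measurable_itv_mu_g.
  - by apply: integrable_subitv ni => //; exact: ltW.
  - by apply: integrable_subitv fi => //; exact: ltW.
apply: measurable_funB; apply: ge0_case => // s.
by rewrite -lerBlDr sub0r -normrN ler_norm.
Qed.

End interval_bounds.

(** * Membership in $L_g^1$ and $L_g^\infty$ in terms of integrability and bounds *)

Section Lg_spaces.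
Context (R : realType) (t0 : R) (alpha : {posnum R}).
Notation mu := (mu_g t0 alpha).
Notation carT := (caratheodory_type (mu_ext (borel_mu t0 alpha))).

Lemma in_Lg1P (T : R) (u : R -> R) :
  in_Lg T t0 alpha 1 u <-> mu.-integrable `[0, T[ (EFin \o u).
Proof.
rewrite /in_Lg; apply: (iff_trans (Lfun1_integrable _ _)).
rewrite -restrict_EFin; apply: iff_sym.
by apply: integrable_mkcond; exact: measurable_itv_mu_g.
Qed.

(** The norm of exponent [+oo] is an essential supremum guarded by a test that the whole space has
    positive measure; the atom settles this test. *)
Lemma mu_g_setT_gt0 : (0 < mu setT)%E.
Proof.
have a0 : (0 < mu [set t0])%E by rewrite mu_g_set1 lte_fin.
apply: (lt_le_trans a0); apply: le_measure; rewrite ?inE//.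
exact: measurable_set1_mu_g.
Qed.

Lemma in_LgyP (T : R) (psi : R -> R) :
  in_Lg T t0 alpha +oo%E psi <->
  measurable_fun (`[0, T[ : set carT) psi /\
  exists2 K, 0 <= K & {ae mu, forall s, s \in `[0, T[ -> `|psi s| <= K}.
Proof.
have mD := measurable_itv_mu_g t0 alpha `[0, T[.
rewrite /in_Lg inE; split.
- move=> /andP[]; rewrite inE/= => mpsi; rewrite inE/= /finite_norm unlock.
  rewrite mu_g_setT_gt0 => /ess_supr_bounded[M psiM].
  split; first exact/(measurable_restrictT _ mD).
  exists `|M|; first by [].
  apply: filterS psiM => s psiM sT; rewrite (le_trans _ (ler_norm _))//.
  by apply: le_trans psiM; rewrite patchE mem_set.
- move=> [mpsi [K K0 psiK]]; apply/andP; split; rewrite inE/=.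
    exact/(measurable_restrictT _ mD).
  rewrite /finite_norm unlock mu_g_setT_gt0; apply: (@le_lt_trans _ _ K%:E).
    apply/ess_supP; apply: negligibleS psiK; apply: subsetC => s psiK.
    by rewrite /= lee_fin patchE; case: ifPn => [/set_mem/psiK//|_]; rewrite normr0.
  by rewrite ltry.
Qed.

End Lg_spaces.

(** * The flow of the cubic equation away from the atom *)

(** The value at time [s] of the solution of $x' = -x^3$ that starts at [x]. *)
Definition cubic_flow (R : realType) (x s : R) : R :=
  x / Num.sqrt (1 + 2 * s * x ^+ 2).

Section cubic_flow.
Context (R : realType).
Implicit Types x s t : R.

Lemma ler_pow3 (x y : R) : 0 <= x -> x <= y -> x ^+ 3 <= y ^+ 3.
Proof. by move=> x0 xy; rewrite lerXn2r// ?nnegrE// (le_trans x0). Qed.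

Lemma cubic_flow0 x : cubic_flow x 0 = x.
Proof. by rewrite /cubic_flow mulr0 mul0r addr0 sqrtr1 divr1. Qed.

Lemma cubic_flow_den_ge1 x s : 0 <= s -> 1 <= Num.sqrt (1 + 2 * s * x ^+ 2).
Proof.
move=> s0; rewrite -[leLHS]sqrtr1 ler_wsqrtr// lerDl.
by rewrite mulr_ge0 ?sqr_ge0// mulr_ge0.
Qed.

Lemma norm_cubic_flow_le x s : 0 <= s -> `|cubic_flow x s| <= `|x|.
Proof.
move=> s0; have d1 := cubic_flow_den_ge1 x s0.
have d0 := lt_le_trans ltr01 d1.
by rewrite normrM normfV (gtr0_norm d0) ler_pdivrMr// ler_peMr.
Qed.

(* With a and b the square roots at s and t, m is 2 x ^ 3 / (a b (a + b)), which
   lies between the cubes of the flow at s and t. *)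
Lemma cubic_flow_increment x s t : 0 <= s -> s <= t -> exists2 m,
  cubic_flow x s - cubic_flow x t = (t - s) * m &
  forall r, s <= r -> r <= t ->
    `|cubic_flow x r ^+ 3 - m| <=
      `|cubic_flow x s| ^+ 3 - `|cubic_flow x t| ^+ 3.
Proof.
move=> s0 st.
have t_ge0 := le_trans s0 st.
have a1 := cubic_flow_den_ge1 x s0; have b1 := cubic_flow_den_ge1 x t_ge0.
have a2 : Num.sqrt (1 + 2 * s * x ^+ 2) ^+ 2 = 1 + 2 * s * x ^+ 2.
  by rewrite sqr_sqrtr// addr_ge0// mulr_ge0 ?sqr_ge0// mulr_ge0.
have b2 : Num.sqrt (1 + 2 * t * x ^+ 2) ^+ 2 = 1 + 2 * t * x ^+ 2.
  by rewrite sqr_sqrtr// addr_ge0// mulr_ge0 ?sqr_ge0// mulr_ge0.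
rewrite /cubic_flow.
have mono r1 r2 : r1 <= r2 ->
    Num.sqrt (1 + 2 * r1 * x ^+ 2) <= Num.sqrt (1 + 2 * r2 * x ^+ 2).
  by move=> r12; rewrite ler_wsqrtr// lerD2l ler_wpM2r ?sqr_ge0// ler_wpM2l.
move: a1 a2 b1 b2 (mono) => + + + + {}mono.
move: (mono s) (mono^~ t).
set a := Num.sqrt (1 + 2 * s * x ^+ 2); set b := Num.sqrt (1 + 2 * t * x ^+ 2).
move=> am bm a1 a2 b1 b2.
have a0 := lt_le_trans ltr01 a1; have b0 := lt_le_trans ltr01 b1.
exists (2 * x ^+ 3 / (a * b * (a + b))).
  have ab0 : a + b != 0 by rewrite gt_eqF// addr_gt0.
  have -> : (t - s) * (2 * x ^+ 3 / (a * b * (a + b))) =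
      (b ^+ 2 - a ^+ 2) * x / (a * b * (a + b)).
    by rewrite a2 b2; field; rewrite ab0 !gt_eqF.
  by field; rewrite ab0 !gt_eqF.
move=> r sr rt.
have := am _ sr; have := bm _ rt.
set d := Num.sqrt (1 + 2 * r * x ^+ 2) => db ad.
have d0 := lt_le_trans a0 ad.
rewrite !normrM !normfV !(gtr0_norm a0) !(gtr0_norm b0) !exprMn.
have -> : x ^+ 3 * d^-1 ^+ 3 - 2 * x ^+ 3 / (a * b * (a + b)) =
    x ^+ 3 * (d^-1 ^+ 3 - 2 * a^-1 ^+ 2 * b^-1 ^+ 2 / (a^-1 + b^-1)).
  have ab0 : a + b != 0 by rewrite gt_eqF// addr_gt0.
  by field; rewrite addrC ab0 !gt_eqF.
rewrite normrM normrX -mulrBr ler_wpM2l ?exprn_ge0//.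
have : b^-1 <= d^-1 by rewrite lef_pV2.
have : d^-1 <= a^-1 by rewrite lef_pV2.
have : 0 < b^-1 by rewrite invr_gt0.
(* In the reciprocals, [D ^+ 3] and [2 * A ^+ 2 * B ^+ 2 / (A + B)] both lie between [B ^+ 3] and
   [A ^+ 3], so they differ by at most [A ^+ 3 - B ^+ 3]. *)
move: (a^-1) (b^-1) (d^-1) => A B D B0 DA BD.
have D3A : D ^+ 3 <= A ^+ 3 by apply: ler_pow3 => //; lra.
have B3D : B ^+ 3 <= D ^+ 3 by apply: ler_pow3 => //; lra.
have AB0 : 0 < A + B by lra.
have mA : 2 * A ^+ 2 * B ^+ 2 / (A + B) <= A ^+ 3.
  rewrite ler_pdivrMr//.
  (* This product is [A ^+ 3 * (A + B) - 2 * A ^+ 2 * B ^+ 2]; the lower bound below rests on a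
     similar factorization. *)
  have : 0 <= A ^+ 2 * ((A - B) * (A + 2 * B)).
    by apply: mulr_ge0; [exact: sqr_ge0|apply: mulr_ge0; lra].
  by lra.
have Bm : B ^+ 3 <= 2 * A ^+ 2 * B ^+ 2 / (A + B).
  rewrite ler_pdivlMr//.
  have : 0 <= B ^+ 2 * ((A - B) * (2 * A + B)).
    by apply: mulr_ge0; [exact: sqr_ge0|apply: mulr_ge0; lra].
  by lra.
by rewrite ler_norml; lra.
Qed.

End cubic_flow.

(** * Increments of primitives *)

Section primitive.
Context (R : realType) (t0 : R) (alpha : {posnum R}).
Notation mu := (mu_g t0 alpha).
Notation carT := (caratheodory_type (mu_ext (borel_mu t0 alpha))).

Lemma Rintegral_itvxx (a : R) (f : R -> R) : \int[mu]_(s in `[a, a[) f s = 0.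
Proof.
have -> : `[a, a[%classic = set0 :> set R by rewrite set_itvco0.
exact: Rintegral_set0.
Qed.

Lemma Rintegral_itv_incr (T s t : R) (f : R -> R) :
  mu.-integrable `[0, T[ (EFin \o f) -> 0 <= s -> s <= t -> t <= T ->
  \int[mu]_(r in `[0, t[) f r =
  \int[mu]_(r in `[0, s[) f r + \int[mu]_(r in `[s, t[) f r.
Proof.
by move=> fi s0 st tT; apply: Rintegral_itv_cat => //; exact: integrable_subitv fi.
Qed.

Lemma le_norm_Rintegral_itv (T s r t : R) (f : R -> R) :
  mu.-integrable `[0, T[ (EFin \o f) -> 0 <= s -> s <= r -> r <= t -> t <= T ->
  `|\int[mu]_(x in `[s, r[) f x| <= \int[mu]_(x in `[s, t[) `|f x|.
Proof.
move=> fi s0 sr rt tT.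
have ni : mu.-integrable `[0, T[ (EFin \o (fun x => `|f x|)).
  exact: integrable_norm fi.
have rT := le_trans rt tT.
apply: (@le_trans _ _ (\int[mu]_(x in `[s, r[) `|f x|)).
  apply: le_normr_Rintegral; first exact: measurable_itv_mu_g.
  exact: integrable_subitv fi.
rewrite (@Rintegral_itv_cat R t0 alpha s r t (fun x => `|f x|))//.
  by rewrite lerDl; apply: Rintegral_ge0.
exact: integrable_subitv ni.
Qed.

End primitive.

(** * Test functions and integration by parts *)

Section integration_by_parts_formula.
Context (R : realType) (t0 : R) (alpha : {posnum R}).
Notation mu := (mu_g t0 alpha).
Notation carT := (caratheodory_type (mu_ext (borel_mu t0 alpha))).

Lemma ae_bounded_integrable (T K : R) (psi : R -> R) : 0 <= T ->
  measurable_fun (`[0, T[ : set carT) psi -> 0 <= K ->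
  {ae mu, forall s, s \in `[0, T[ -> `|psi s| <= K} ->
  mu.-integrable `[0, T[ (EFin \o psi).
Proof.
move=> T0 mpsi K0 psiK; have mD := measurable_itv_mu_g t0 alpha `[0, T[.
have mE := (measurable_EFinP _ _).2 mpsi.
apply/integrableP; split => //.
apply: (@le_lt_trans _ _ (K%:E * mu `[0%R, T[)%E).
  by apply: integral_le_bound => //; rewrite lee_fin.
by rewrite lte_mul_pinfty//; exact: mu_g_itv_lty.
Qed.

Lemma test_fun_increment (T c s t : R) (psi : R -> R) :
  mu.-integrable `[0, T[ (EFin \o psi) -> 0 <= s -> s <= t -> t <= T ->
  test_fun t0 alpha c psi t =
  test_fun t0 alpha c psi s + \int[mu]_(r in `[s, t[) psi r.
Proof.
move=> psii s0 st tT; rewrite /test_fun -addrA; congr (_ + _).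
exact: Rintegral_itv_incr psii _ _ _.
Qed.

(** The increment of the test function from [t0] to [t] is the share of the atom plus an integral
    off [t0], and the latter is at most [K * (t - t0)] in absolute value. *)
Lemma Sg_test_fun (T K c : R) (psi : R -> R) : 0 <= t0 -> t0 < T ->
  mu.-integrable `[0, T[ (EFin \o psi) -> 0 <= K ->
  {ae mu, forall s, s \in `[0, T[ -> `|psi s| <= K} ->
  Sg t0 (test_fun t0 alpha c psi) t0 =
  test_fun t0 alpha c psi t0 + alpha%:num * psi t0.
Proof.
move=> t0_ge0 t0T psii K0 psiK; rewrite /Sg eqxx.
apply/cvg_lim => //; apply/cvgrPdist_le => e e0.
near=> t.
have t0t : t0 < t by near: t; exact: nbhs_right_gt.
have tT : t < T by near: t; exact: nbhs_right_lt.
rewrite (test_fun_increment c psii t0_ge0 (ltW t0t) (ltW tT)).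
have psii' : mu.-integrable `[t0, t[ (EFin \o psi).
  by apply: integrable_subitv psii => //; exact: ltW.
rewrite (Rintegral_itvD_set1 psii') lexx t0t/=.
rewrite opprD addrACA subrr add0r opprD addrCA subrr addr0 normrN.
apply: (@le_trans _ _ (K * (t - t0))).
  apply: (Rintegral_itvD_bound (ltW t0t)) => //.
  apply: negligibleS psiK; apply: subsetC => s psiK [/= st _]; apply: psiK.
  by move: st; rewrite !in_itv/= => /andP[t0s /lt_trans-> //]; rewrite (le_trans _ t0s).
(* Dividing by [K + 1] instead of [K] covers [K = 0]. *)
have : t - t0 <= e / (K + 1).
  rewrite lerBlDl; near: t; apply: nbhs_right_le.
  by rewrite ltrDl divr_gt0// ltr_wpDl.
rewrite ler_pdivlMr ?ltr_wpDl// => h; apply: le_trans h.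
by rewrite mulrC; apply: ler_wpM2l; [rewrite subr_ge0 ltW|rewrite lerDl].
Unshelve. all: by end_near. Qed.

(** The difference of the two sides, taken on [[0, t[], is constant in [t] on each side of [t0]. The
    right limit in [Sg] is what makes the atom contribute no error: at [t0] the factor [V] is taken
    before the jump and [phi] after it. *)
Lemma mu_g_integration_by_parts (T K c u0 : R) (f V psi : R -> R) :
  0 <= t0 -> t0 < T ->
  mu.-integrable `[0, T[ (EFin \o f) ->
  (forall t : R, 0 <= t -> t <= T -> V t = u0 - \int[mu]_(s in `[0, t[) f s) ->
  measurable_fun (`[0, T[ : set carT) psi -> 0 <= K ->
  {ae mu, forall s, s \in `[0, T[ -> `|psi s| <= K} ->
  let phi := test_fun t0 alpha c psi in
  [/\ mu.-integrable `[0, T[ (EFin \o (fun s => V s * psi s)),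
      mu.-integrable `[0, T[ (EFin \o (fun s => f s * Sg t0 phi s)) &
  \int[mu]_(s in `[0, T[) (V s * psi s)
    - \int[mu]_(s in `[0, T[) (f s * Sg t0 phi s) = V T * phi T - V 0 * phi 0].
Proof.
move=> t0_ge0 t0T fi VE mpsi K0 psiK phi.
have T0 : 0 <= T := ltW (le_lt_trans t0_ge0 t0T).
have psii := ae_bounded_integrable T0 mpsi K0 psiK.
have mD := measurable_itv_mu_g t0 alpha `[0, T[.
have phi_incr (s t : R) : 0 <= s -> s <= t -> t <= T ->
    phi t = phi s + \int[mu]_(r in `[s, t[) psi r.
  exact: test_fun_increment.
have V_incr (s t : R) : 0 <= s -> s <= t -> t <= T ->
    V t = V s - \int[mu]_(r in `[s, t[) f r.
  move=> s0 st tT; rewrite (VE t (le_trans s0 st) tT).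
  rewrite (VE s s0 (le_trans st tT)).
  by rewrite (Rintegral_itv_incr fi s0 st tT) opprD addrA.
have mV : measurable_fun (`[0, T[ : set carT) V.
  apply: (@eq_measurable_fun _ _ carT _ _
    (fun t => u0 - \int[mu]_(s in `[0, t[) f s)).
    move=> t; rewrite inE/= in_itv/= => /andP[t_ge0 tT].
    by rewrite (VE t t_ge0 (ltW tT)).
  exact: (measurable_funB (measurable_cst u0) (measurable_primitive T0 fi)).
have mphi : measurable_fun (`[0, T[ : set carT) phi.
  exact: (measurable_funD (measurable_cst c) (measurable_primitive T0 psii)).
(* [Sg t0 phi] differs from [phi] by a multiple of the indicator of [t0], which yields both its
   measurability and its bound. *)
have SgE s : Sg t0 phi s = phi s + alpha%:num * psi t0 * \1_[set t0] s.
  rewrite indicE; have [->|st0] := eqVneq s t0.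
    by rewrite (Sg_test_fun c t0_ge0 t0T psii K0 psiK) mem_set// mulr1.
  rewrite /Sg (negbTE st0) memNset ?mulr0 ?addr0//=.
  exact/eqP.
have mS : measurable_fun (`[0, T[ : set carT) (Sg t0 phi).
  apply: (@eq_measurable_fun _ _ carT _ _
    (fun s => phi s + alpha%:num * psi t0 * \1_[set t0] s)).
    by move=> s _; rewrite SgE.
  apply: (measurable_funD mphi); apply: (measurable_funM (measurable_cst _)).
  by apply: measurable_indic; exact: measurable_set1_mu_g.
have Vb (s : R) : s \in `[0, T[ -> `|V s| <= `|u0| + \int[mu]_(x in `[0, T[) `|f x|.
  rewrite in_itv/= => /andP[s0 sT]; rewrite (VE s s0 (ltW sT)).
  apply: (le_trans (ler_normB _ _)); rewrite lerD2l.
  by apply: (le_norm_Rintegral_itv fi) => //; exact: ltW.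
pose B : R := `|c| + \int[mu]_(x in `[0, T[) `|psi x| + `|alpha%:num * psi t0|.
have Sb (s : R) : s \in `[0, T[ -> `|Sg t0 phi s| <= B.
  rewrite in_itv/= => /andP[s0 sT]; rewrite SgE.
  apply: (le_trans (ler_normD _ _)); apply: lerD.
    apply: (le_trans (ler_normD _ _)); rewrite lerD2l.
    by apply: (le_norm_Rintegral_itv psii) => //; exact: ltW.
  by rewrite normrM ler_piMr// indicE; case: (_ \in _); rewrite ?normr1 ?normr0.
have Vpsii : mu.-integrable `[0, T[ (EFin \o (fun s => V s * psi s)).
  exact: (integrable_mul_bounded mD mV Vb psii).
have fSi : mu.-integrable `[0, T[ (EFin \o (fun s => f s * Sg t0 phi s)).
  have -> : EFin \o (fun s => f s * Sg t0 phi s) =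
      EFin \o (fun s => Sg t0 phi s * f s).
    by apply/funext => s /=; rewrite mulrC.
  exact: (integrable_mul_bounded mD mS Sb fi).
split => //.
pose H (t : R) : R := V t * phi t - \int[mu]_(s in `[0, t[) (V s * psi s)
  + \int[mu]_(s in `[0, t[) (f s * Sg t0 phi s).
suff HT : H T = H 0.
  have move_terms (a b d e : R) : a - b + d = e -> b - d = a - e.
    by move=> <-; ring.
  apply: move_terms; rewrite -/(H T) HT /H.
  by rewrite (Rintegral_itvxx t0 alpha 0 (fun s => V s * psi s))
    (Rintegral_itvxx t0 alpha 0 (fun s => f s * Sg t0 phi s)) subr0 addr0.
pose N (t : R) : R := \int[mu]_(s in `[0, t[) `|f s|.
have ni : mu.-integrable `[0, T[ (EFin \o (fun x => `|f x|)).
  exact: integrable_norm fi.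
(* Under the last condition [[s, t[] can contain [t0] only as its left end, since the right end is
   excluded. *)
have incr (s t : R) : 0 <= s -> s <= t -> t <= T -> (t <= t0) || (t0 <= s) ->
    `|H t - H s| <= 2 * K * (t - s) * (N t - N s).
  move=> s0 st tT t0st.
  have mst := measurable_itv_mu_g t0 alpha `[s, t[.
  have sub g : mu.-integrable `[0, T[ (EFin \o g) ->
      mu.-integrable `[s, t[ (EFin \o g) by apply: integrable_subitv.
  have NE : N t - N s = \int[mu]_(r in `[s, t[) `|f r|.
    by rewrite /N (Rintegral_itv_incr ni s0 st tT) addrAC subrr add0r.
  have N0 : 0 <= N t - N s by rewrite NE; exact: Rintegral_ge0.
  have Vsi := @RintegralZl _ _ _ mu `[s, t[%classic psi (V s) mst (sub _ psii).
  have phifi := @RintegralZr _ _ _ mu `[s, t[%classic f (phi t) mst (sub _ fi).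
  have iVs : mu.-integrable `[s, t[ (EFin \o (fun r => V s * psi r)).
    exact: (integrableZl mst (V s) (sub _ psii)).
  have iphif : mu.-integrable `[s, t[ (EFin \o (fun r => f r * phi t)).
    exact: (integrableZr mst (phi t) (sub _ fi)).
  have I1 := @RintegralB _ _ _ mu `[s, t[%classic (fun r => V r * psi r)
    (fun r => V s * psi r) mst (sub _ Vpsii) iVs.
  have I2 := @RintegralB _ _ _ mu `[s, t[%classic (fun r => f r * Sg t0 phi r)
    (fun r => f r * phi t) mst (sub _ fSi) iphif.
  have iI1 : mu.-integrable `[s, t[ (EFin \o (fun r => V r * psi r - V s * psi r)).
    exact: (integrableB mst (sub _ Vpsii) iVs).
  have iI2 : mu.-integrable `[s, t[
      (EFin \o (fun r => f r * Sg t0 phi r - f r * phi t)).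
    exact: (integrableB mst (sub _ fSi) iphif).
  (* The increment of the product is [V s * (phi t - phi s) + (V t - V s) * phi t]: [V] is frozen at
     the left end and [phi] at the right end, so both integrands become small differences. *)
  have HE : H t - H s =
      - (\int[mu]_(r in `[s, t[) (V r * psi r - V s * psi r))
      + \int[mu]_(r in `[s, t[) (f r * Sg t0 phi r - f r * phi t).
    rewrite I1 I2 Vsi phifi.
    have alg (Vt Vs pt ps A A' a C C' e p F : R) :
        Vt = Vs - F -> pt = ps + p -> A' = A + a -> C' = C + e ->
        (Vt * pt - A' + C') - (Vs * ps - A + C) =
        - (a - Vs * p) + (e - F * pt).
      by move=> -> -> -> ->; ring.
    rewrite /H; apply: alg; [exact: V_incr|exact: phi_incr| |].
    - exact: (Rintegral_itv_incr Vpsii s0 st tT).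
    - exact: (Rintegral_itv_incr fSi s0 st tT).
  have psiKst : {ae mu, forall r, (`[s, t[ `\ t0) r -> `|psi r| <= K}.
    apply: negligibleS psiK; apply: subsetC => r psiK [/= rst _]; apply: psiK.
    by move: rst; rewrite !in_itv/= => /andP[sr rt];
      rewrite (le_trans s0 sr) (lt_le_trans rt).
  have B1 : `|\int[mu]_(r in `[s, t[) (V r * psi r - V s * psi r)| <=
      K * (t - s) * (N t - N s).
    rewrite (Rintegral_itvD_set1 iI1).
    have -> : (if s <= t0 < t then
        alpha%:num * (V t0 * psi t0 - V s * psi t0) else 0) = 0.
      case: ifPn => // /andP[st0 t0t].
      have -> : t0 = s by move: t0st; rewrite leNgt t0t/= => ?; apply: le_anti; apply/andP.
      by rewrite subrr mulr0.
    rewrite addr0.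
    have -> : K * (t - s) * (N t - N s) = (N t - N s) * K * (t - s) by ring.
    apply: (Rintegral_itvD_bound st iI1 (mulr_ge0 N0 K0)).
    apply: negligibleS psiKst; apply: subsetC => r /[swap] rst /(_ rst) psirK.
    rewrite -mulrBl normrM; apply: ler_pM => //.
    have [/= + _] := rst; rewrite in_itv/= => /andP[sr rt].
    rewrite (V_incr s r)// ?(le_trans (ltW rt))// addrAC subrr add0r normrN NE.
    by apply: (le_norm_Rintegral_itv fi) => //; exact: ltW.
  have B2 : `|\int[mu]_(r in `[s, t[) (f r * Sg t0 phi r - f r * phi t)| <=
      K * (t - s) * (N t - N s).
    apply: (le_trans (le_normr_Rintegral mst iI2)).
    rewrite NE mulrC -(@RintegralZr _ _ _ mu `[s, t[%classic
      (fun r => `|f r|) (K * (t - s)) mst (sub _ ni)).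
    apply: le_Rintegral => //.
    - exact: integrable_norm iI2.
    - exact: (integrableZr mst (K * (t - s)) (sub _ ni)).
    move=> r /=; rewrite in_itv/= => /andP[sr rt].
    rewrite -mulrBr normrM ler_wpM2l//.
    have r0 := le_trans s0 sr.
    have irt : mu.-integrable `[r, t[ (EFin \o psi).
      exact: integrable_subitv psii.
    (* For [r = t0] the right limit has already absorbed the jump of [phi]; for other [r] in [[s,
       t[] the atom is not in [[r, t[]. *)
    have -> : Sg t0 phi r - phi t = - \int[mu]_(x in `[r, t[ `\ t0) psi x.
      rewrite (phi_incr _ _ r0 (ltW rt) tT) (Rintegral_itvD_set1 irt) SgE indicE.
      have [rt0|rt0] := eqVneq r t0.
        rewrite mem_set// rt0 lexx -rt0 rt /= rt0 mulr1.
        have alg (p q i : R) : p + q - (p + (i + q)) = - i by ring.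
        exact: alg.
      rewrite memNset; last exact/eqP.
      case: ifPn => [/andP[rt0' t0t]|_]; last first.
        by rewrite /= mulr0 !addr0 opprD addrA subrr add0r.
      have t0s : t0 <= s by move: t0st; rewrite leNgt t0t.
      by case/eqP : rt0; apply: le_anti; rewrite rt0' (le_trans t0s sr).
    rewrite normrN; apply: (@le_trans _ _ (K * (t - r))).
      apply: (Rintegral_itvD_bound (ltW rt)) => //.
      apply: negligibleS psiKst; apply: subsetC => x psiKx [/= xrt xt0].
      apply: psiKx; split=> //; move: xrt; rewrite /= !in_itv/= => /andP[rx ->].
      by rewrite (le_trans sr rx).
    by rewrite ler_wpM2l// lerD2l lerN2.
  rewrite HE; apply: (le_trans (ler_normD _ _)); rewrite normrN.
  have -> : 2 * K * (t - s) * (N t - N s) =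
    K * (t - s) * (N t - N s) + K * (t - s) * (N t - N s) by ring.
  exact: lerD.
(* The two sides of [t0] are treated separately, each with control function [N] and one [K] from
   each of the two integrals. *)
have -> : H T = H t0.
  apply: (@eq_of_increment_bound _ _ N (2 * K)); first exact: ltW.
  move=> s t t0s st tT; apply: incr => //; first exact: le_trans t0s.
  by rewrite t0s orbT.
apply: (@eq_of_increment_bound _ _ N (2 * K)) => //.
move=> s t s0 st tt0; apply: incr => //; last by rewrite tt0.
by rewrite (le_trans tt0)// ltW.
Qed.

End integration_by_parts_formula.

(** * Uniqueness for the integral equation *)

Lemma cube_diff_le (R : realType) (B x y : R) : `|x| <= B -> `|y| <= B ->
  `|x ^+ 3 - y ^+ 3| <= 3 * B ^+ 2 * `|x - y|.
Proof.
move=> xB yB; have B0 : 0 <= B := le_trans (normr_ge0 x) xB.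
have -> : x ^+ 3 - y ^+ 3 = (x * x + x * y + y * y) * (x - y) by ring.
rewrite normrM ler_wpM2r//.
have bb (u v : R) : `|u| <= B -> `|v| <= B -> `|u * v| <= B ^+ 2.
  by move=> uB vB; rewrite normrM expr2 ler_pM.
have := bb _ _ xB xB; have := bb _ _ xB yB; have := bb _ _ yB yB.
have := ler_normD (x * x + x * y) (y * y); have := ler_normD (x * x) (x * y).
lra.
Qed.

Section uniqueness.
Context (R : realType) (t0 : R) (alpha : {posnum R}).
Notation mu := (mu_g t0 alpha).
Notation carT := (caratheodory_type (mu_ext (borel_mu t0 alpha))).

(* On a step of length [d] with [3 * B ^+ 2 * d <= 1 / 2] the solution operator
   is a contraction, provided that the atom is absent or sits at the left end,
   where the two solutions already agree. *)
Lemma integral_eq_unique (T u0 : R) (V W : R -> R) : 0 <= t0 -> t0 <= T ->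
  mu.-integrable `[0, T[ (EFin \o (fun s => V s ^+ 3)) ->
  mu.-integrable `[0, T[ (EFin \o (fun s => W s ^+ 3)) ->
  (forall t : R, 0 <= t -> t <= T ->
    V t = u0 - \int[mu]_(s in `[0, t[) (V s ^+ 3)) ->
  (forall t : R, 0 <= t -> t <= T ->
    W t = u0 - \int[mu]_(s in `[0, t[) (W s ^+ 3)) ->
  forall t : R, 0 <= t -> t <= T -> V t = W t.
Proof.
move=> t0_ge0 t0T iV iW VE WE.
have T0 : 0 <= T := le_trans t0_ge0 t0T.
(* A common bound for both solutions, read off from their integral equations; on it the cube has
   Lipschitz constant [L = 3 * B ^+ 2]. *)
pose B : R := `|u0| + \int[mu]_(x in `[0, T[) `|V x ^+ 3|
  + \int[mu]_(x in `[0, T[) `|W x ^+ 3|.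
have VB (t : R) : 0 <= t -> t <= T -> `|V t| <= B.
  move=> t_ge0 tT; rewrite (VE t t_ge0 tT); apply: (le_trans (ler_normB _ _)).
  rewrite /B -addrA lerD2l; apply: (le_trans (le_norm_Rintegral_itv iV _ t_ge0 tT _)) => //.
  by rewrite lerDl; exact: Rintegral_ge0.
have WB (t : R) : 0 <= t -> t <= T -> `|W t| <= B.
  move=> t_ge0 tT; rewrite (WE t t_ge0 tT); apply: (le_trans (ler_normB _ _)).
  rewrite /B -addrA lerD2l; apply: (le_trans (le_norm_Rintegral_itv iW _ t_ge0 tT _)) => //.
  by rewrite lerDr; exact: Rintegral_ge0.
have B0 : 0 <= B := le_trans (normr_ge0 _) (VB 0 (lexx 0) T0).
clearbody B; pose L : R := 3 * B ^+ 2.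
have L0 : 0 <= L by rewrite mulr_ge0// sqr_ge0.
pose h (s : R) : R := V s ^+ 3 - W s ^+ 3.
have ih : mu.-integrable `[0, T[ (EFin \o h).
  exact: (integrableB (measurable_itv_mu_g t0 alpha _) iV iW).
have hE (t : R) : 0 <= t -> t <= T -> V t - W t = - (\int[mu]_(s in `[0, t[) h s).
  move=> t_ge0 tT.
  have sub g : mu.-integrable `[0, T[ (EFin \o g) ->
      mu.-integrable `[0, t[ (EFin \o g) by apply: integrable_subitv.
  rewrite (VE t t_ge0 tT) (WE t t_ge0 tT).
  have := @RintegralB _ _ _ mu `[0, t[%classic (fun s => V s ^+ 3)
    (fun s => W s ^+ 3) (measurable_itv_mu_g t0 alpha _) (sub _ iV) (sub _ iW).
  by move=> ->; rewrite opprB addrC opprB addrA addrNK.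
have step (a b : R) : 0 <= a -> a <= b -> b <= T -> (b <= t0) || (t0 <= a) ->
    V a = W a -> L * (b - a) <= 2^-1 -> V b = W b.
  move=> a0 ab bT t0ab VWa Lba.
  (* Each application of the contraction halves the error. As [1 / (2 * (n + 1)) <= 1 / (n + 2)],
     the weaker harmonic rate suffices for the induction and for the final squeeze. *)
  suff cl (n : nat) (t : R) : a <= t -> t <= b -> `|V t - W t| <= 2 * B / n.+1%:R.
    apply/eqP; rewrite -subr_eq0 -normr_le0.
    by apply: (@squeeze_geometric _ _ (2 * B)) => n; exact: cl.
  elim: n t => [|n IH] t at_ tb.
    have t_ge0 := le_trans a0 at_; have tT := le_trans tb bT.
    rewrite divr1; apply: (le_trans (ler_normB _ _)).
    rewrite mulr_natl mulr2n; exact: (lerD (VB t t_ge0 tT) (WB t t_ge0 tT)).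
  have t_ge0 := le_trans a0 at_; have tT := le_trans tb bT.
  have iat : mu.-integrable `[a, t[ (EFin \o h) by exact: integrable_subitv ih.
  have -> : V t - W t = - (\int[mu]_(s in `[a, t[ `\ t0) h s).
    rewrite (hE t t_ge0 tT) (Rintegral_itv_incr ih a0 at_ tT) opprD.
    rewrite -(hE a a0 (le_trans at_ tT)) VWa subrr add0r.
    rewrite (Rintegral_itvD_set1 iat); case: ifPn => [/andP[at0 t0t]|_].
      have -> : t0 = a.
        apply: le_anti; rewrite at0 andbT; move: t0ab.
        by rewrite leNgt (lt_le_trans t0t tb).
      by rewrite /h VWa subrr mulr0 addr0.
    by rewrite addr0.
  rewrite normrN.
  pose C : R := 2 * B / n.+1%:R.
  have C0 : 0 <= C by rewrite divr_ge0// mulr_ge0.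
  apply: (@le_trans _ _ (L * C * (t - a))).
    apply: (Rintegral_itvD_bound at_ iat (mulr_ge0 L0 C0)).
    apply: aeW => s [/= + _]; rewrite in_itv/= => /andP[as_ st].
    have s0 := le_trans a0 as_; have sT := le_trans (ltW st) tT.
    apply: (le_trans (cube_diff_le (VB s s0 sT) (WB s s0 sT))).
    by rewrite ler_wpM2l//; apply: IH => //; exact: (le_trans (ltW st) tb).
  apply: (@le_trans _ _ (C * 2^-1)).
    rewrite mulrAC mulrC ler_wpM2l//; apply: le_trans Lba.
    by rewrite ler_wpM2l// lerD2r.
  rewrite /C -mulrA -invfM ler_wpM2l ?mulr_ge0//.
  by rewrite lef_pV2 ?posrE ?mulr_gt0// -natrM ler_nat muln2 -addnn addSn addnS !ltnS leq_addr.
(* The step length gives [L * d = L / (2 * (L + 1))], at most one half, and makes sense also for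
   [L = 0]. *)
pose d : R := (2 * (L + 1))^-1.
have d0 : 0 < d by rewrite invr_gt0 mulr_gt0// ltr_wpDl.
have Ld : L * d <= 2^-1.
  by rewrite /d invfM mulrCA ler_piMr// ler_pdivrMr ?ltr_wpDl// mul1r lerDl.
have long (a b : R) : 0 <= a -> a <= b -> b <= T -> (b <= t0) || (t0 <= a) ->
    V a = W a -> V b = W b.
  move=> a0 ab bT t0ab VWa.
  (* Agreement advances by one length [d] at a time; by the Archimedean property finitely many steps
     reach [b]. *)
  suff steps (k : nat) (t : R) : a <= t -> t <= b -> t <= a + k%:R * d -> V t = W t.
    apply: (steps (Num.bound ((b - a) / d))) => //.
    rewrite -lerBlDl -ler_pdivrMr//; apply: ltW; apply: archi_boundP.
    by rewrite divr_ge0 ?subr_ge0// ltW.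
  elim: k t => [|k IH] t at_ tb.
    by rewrite mul0r addr0 => ta; rewrite (@le_anti _ _ t a)// at_ ta.
  move=> tk; have [tk'|kt] := leP t (a + k%:R * d); first exact: IH.
  have ak : a <= a + k%:R * d by rewrite lerDl mulr_ge0// ltW.
  apply: (step (a + k%:R * d)) => //; first exact: le_trans ak.
  - exact: ltW.
  - exact: le_trans tb bT.
  - case/orP : t0ab => [bt0|t0a]; first by rewrite (le_trans tb).
    by rewrite (le_trans t0a ak) orbT.
  - by apply: IH => //; exact: le_trans (ltW kt) tb.
  - apply: le_trans Ld; rewrite ler_wpM2l// lerBlDl.
    by move: tk; rewrite -natr1 mulrDl mul1r addrA.
have VW0 : V 0 = W 0.
  rewrite (VE 0 (lexx 0) T0) (WE 0 (lexx 0) T0).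
  by rewrite (Rintegral_itvxx t0 alpha 0 (fun s => V s ^+ 3))
    (Rintegral_itvxx t0 alpha 0 (fun s => W s ^+ 3)).
(* Beyond [t0], agreement is first carried from 0 to [t0] and then restarted there, with the atom at
   the left end. *)
move=> t t_ge0 tT; have [tt0|t0t] := leP t t0.
  by apply: (long 0) => //; rewrite tt0.
apply: (long t0) => //; first exact: ltW.
  by rewrite lexx orbT.
by apply: (long 0) => //; rewrite lexx.
Qed.

End uniqueness.

(** * The explicit function solves the integral equation *)

Section explicit_solution.
Context (R : realType) (t0 : R) (alpha : {posnum R}).
Notation mu := (mu_g t0 alpha).
Notation carT := (caratheodory_type (mu_ext (borel_mu t0 alpha))).

(** Clamping the time at 0 keeps the radicand at least 1, so the reciprocal square root is
    nonincreasing on the whole line and hence Borel. *)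
Lemma measurable_cubic_flow (x c : R) :
  measurable_fun [set: measurableTypeR R]
    (fun s : R => cubic_flow x (Num.max 0 (s - c))).
Proof.
rewrite /cubic_flow; apply: (measurable_funM (measurable_cst x)).
apply: nonincreasing_measurable; first exact: measurableT.
move=> s t st.
have m0 r : 0 <= Num.max 0 (r - c) by rewrite le_max lexx.
have d0 r := lt_le_trans ltr01 (cubic_flow_den_ge1 x (m0 r)).
rewrite lef_pV2 ?posrE ?d0// ler_wsqrtr// lerD2l ler_wpM2r ?sqr_ge0// ler_wpM2l//.
by apply: le_max2 => //; rewrite lerD2r.
Qed.

(** This is $x' = -x^3$ in integrated form. Deleting [t0] makes it hold wherever the atom lies. *)
Lemma Rintegral_cubic_flow (x c b : R) : c <= b ->
  \int[mu]_(s in `[c, b[ `\ t0) (cubic_flow x (s - c) ^+ 3) =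
  x - cubic_flow x (b - c).
Proof.
move=> cb; pose P (s : R) : R := cubic_flow x (s - c).
pose P3 (s : R) : R := P s ^+ 3.
have iP : mu.-integrable `[c, b[ (EFin \o P3).
  apply: (bounded_integrable_itv (K := `|x| ^+ 3) cb).
    apply: (@eq_measurable_fun _ _ carT _ _
        (fun s : R => cubic_flow x (Num.max 0 (s - c)) ^+ 3)).
      move=> s; rewrite inE/= in_itv/= => /andP[cs _].
      by rewrite /P3 /P max_r// subr_ge0.
    apply: measurable_funX; apply: borel_measurable_fun; first exact: measurable_itv.
    exact: measurable_funTS (measurable_cubic_flow x c).
  move=> s; rewrite in_itv/= => /andP[cs _]; rewrite normrX ler_pow3//.
  by apply: norm_cubic_flow_le; rewrite subr_ge0.
pose F (t : R) : R := \int[mu]_(s in `[c, t[ `\ t0) P3 s + P t.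
pose N (t : R) : R := - `|P t| ^+ 3.
(* Over [[s, t[] the increment of [F] is the integral of [P3 - m], with [m] the mean slope from
   [cubic_flow_increment]; its bound is an increment of [N]. *)
have FE : F b = F c.
  apply: (@eq_of_increment_bound _ F N 1) => // s t cs st tb.
  have sc : 0 <= s - c by rewrite subr_ge0.
  have stc : s - c <= t - c by rewrite lerD2r.
  have [m mE mB] := cubic_flow_increment x sc stc.
  have mst := measurable_itvD_mu_g t0 alpha s t.
  have ist : mu.-integrable `[s, t[ (EFin \o P3) by exact: integrable_subitv iP.
  have im : mu.-integrable `[s, t[ (EFin \o (fun=> m)).
    by apply: (bounded_integrable_itv (K := `|m|) st) => //; exact: measurable_cst.
  have iPm : mu.-integrable `[s, t[ (EFin \o (fun r => P3 r - m)).
    exact: (integrableB (measurable_itv_mu_g t0 alpha _) ist im).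
  have ct : mu.-integrable `[c, t[ (EFin \o P3) by exact: integrable_subitv iP.
  have cstE : \int[mu]_(r in `[s, t[ `\ t0) m = m * (t - s).
    have := Rintegral_cst mu mst m; have muE := mu_g_itvD t0 alpha st.
    by move=> ->; congr (_ * _); exact: (congr1 fine muE).
  have -> : F t - F s = \int[mu]_(r in `[s, t[ `\ t0) (P3 r - m).
    have := @RintegralB _ _ _ mu (`[s, t[ `\ t0) P3 (fun=> m) mst
      (integrable_itvD ist) (integrable_itvD im).
    move=> ->; rewrite cstE /F (Rintegral_itvD_cat cs st ct).
    have alg (p i Pt Ps e : R) : Ps - Pt = e -> p + i + Pt - (p + Ps) = i - e.
      by move=> <-; ring.
    apply: alg; rewrite /P mE mulrC; congr (_ * _); ring.
  have -> : 1 * (t - s) * (N t - N s) = (`|P s| ^+ 3 - `|P t| ^+ 3) * (t - s).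
    by rewrite /N; ring.
  apply: (Rintegral_itvD_bound st iPm).
    by apply: le_trans (normr_ge0 _) (mB (s - c) (lexx _) _); rewrite lerD2r.
  apply: aeW => r [/= + _]; rewrite in_itv/= => /andP[sr rt].
  by apply: mB; rewrite lerD2r// ltW.
have := FE; rewrite /F.
have -> : \int[mu]_(s in `[c, c[ `\ t0) P3 s = 0.
  rewrite -(Rintegral_set0 mu P3); congr (Rintegral _ _ _).
  by rewrite set_itvco0 set0D.
have Pc : P c = x by rewrite /P subrr cubic_flow0.
by rewrite add0r Pc => e; rewrite -[LHS](addrK (P b)) e.
Qed.

Lemma explicit_solutionE (u0 s : R) : explicit_solution t0 alpha u0 s =
  if s <= t0 then cubic_flow u0 s else cubic_flow (xplus t0 alpha u0) (s - t0).
Proof. by []. Qed.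

Lemma norm_explicit_solution_le (u0 s : R) : 0 <= s ->
  `|explicit_solution t0 alpha u0 s| <= `|u0| + `|xplus t0 alpha u0|.
Proof.
move=> s0; rewrite explicit_solutionE; have [st0|t0s] := leP s t0.
  by apply: (le_trans (norm_cubic_flow_le u0 s0)); rewrite lerDl.
apply: (@le_trans _ _ `|xplus t0 alpha u0|); last by rewrite lerDr.
by apply: norm_cubic_flow_le; rewrite subr_ge0 ltW.
Qed.

Lemma measurable_explicit_solution (u0 b : R) :
  measurable_fun (`[0, b[ : set carT) (explicit_solution t0 alpha u0).
Proof.
apply: (@eq_measurable_fun _ _ carT _ _ (fun s : R =>
  if s <= t0 then cubic_flow u0 (Num.max 0 (s - 0))
  else cubic_flow (xplus t0 alpha u0) (Num.max 0 (s - t0)))).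
  move=> s; rewrite inE/= in_itv/= => /andP[s0 _].
  rewrite explicit_solutionE; have [st0|t0s] := leP s t0.
    by rewrite subr0 max_r.
  by rewrite max_r// subr_ge0 ltW.
apply: borel_measurable_fun; first exact: measurable_itv.
apply: measurable_funTS; apply: measurable_fun_ifT.
- apply: measurable_fun_ler; first exact: measurable_id.
  exact: measurable_cst.
- exact: measurable_cubic_flow.
- exact: measurable_cubic_flow.
Qed.

Lemma integrable_explicit_solution (u0 b : R) (n : nat) : 0 <= b ->
  mu.-integrable `[0, b[ (EFin \o (fun s => explicit_solution t0 alpha u0 s ^+ n)).
Proof.
move=> b0; pose K : R := `|u0| + `|xplus t0 alpha u0|.
apply: (bounded_integrable_itv (K := K ^+ n) b0).
  by apply: measurable_funX; exact: measurable_explicit_solution.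
move=> s; rewrite in_itv/= => /andP[s0 _]; rewrite normrX.
by apply: lerXn2r; rewrite ?nnegrE ?addr_ge0//; exact: norm_explicit_solution_le.
Qed.

(** Up to and including [t0] the interval [[0, t[] misses the atom. Afterwards the atom contributes
    [alpha * x_- ^ 3], exactly the drop from [x_-] to [x_+], and the flow restarts from [x_+]. *)
Lemma explicit_solution_integral_eq (u0 t : R) : 0 <= t0 -> 0 <= t ->
  explicit_solution t0 alpha u0 t =
  u0 - \int[mu]_(s in `[0, t[) (explicit_solution t0 alpha u0 s ^+ 3).
Proof.
move=> t0_ge0; pose U := explicit_solution t0 alpha u0.
pose U3 (s : R) : R := U s ^+ 3.
have iU (b : R) : 0 <= b -> mu.-integrable `[0, b[ (EFin \o U3).
  exact: integrable_explicit_solution.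
have before (r : R) : 0 <= r -> r <= t0 -> U r = u0 - \int[mu]_(s in `[0, r[) U3 s.
  move=> r0 rt0; rewrite (Rintegral_itvD_set1 (iU r r0)).
  rewrite [t0 < r]ltNge rt0 andbF addr0.
  rewrite (@eq_Rintegral _ _ _ mu _ (fun s : R => cubic_flow u0 (s - 0) ^+ 3)).
    by rewrite (Rintegral_cubic_flow u0 r0) subr0 subKr /U explicit_solutionE rt0.
  move=> s; rewrite inE/= => -[+ _]; rewrite in_itv/= => /andP[_ sr].
  by rewrite subr0 /U3 /U explicit_solutionE (le_trans (ltW sr) rt0).
move=> t_ge0; have [tt0|t0t] := leP t t0; first exact: before.
have Ut0 : U t0 = xminus t0 u0 by rewrite /U explicit_solutionE lexx.
have it : mu.-integrable `[t0, t[ (EFin \o U3).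
  by apply: integrable_subitv (iU t t_ge0).
have after : \int[mu]_(s in `[t0, t[ `\ t0) U3 s = xplus t0 alpha u0 - U t.
  rewrite (@eq_Rintegral _ _ _ mu _
      (fun s : R => cubic_flow (xplus t0 alpha u0) (s - t0) ^+ 3)).
    rewrite (Rintegral_cubic_flow _ (ltW t0t)) /U explicit_solutionE.
    by rewrite leNgt t0t.
  move=> s; rewrite inE/= => -[+ st0]; rewrite in_itv/= => /andP[t0s _].
  rewrite /U3 /U explicit_solutionE ifF//; apply/negbTE; rewrite -ltNge lt_neqAle t0s andbT.
  by apply/eqP => e; apply: st0.
rewrite -/(U t) (Rintegral_itv_cat t0_ge0 (ltW t0t) (iU t t_ge0)).
rewrite (Rintegral_itvD_set1 it) lexx t0t/= after.
have := before t0 t0_ge0 (lexx t0); rewrite /U3 Ut0 /xplus.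
set i := \int[mu]_(s in `[0, t0[) _ => b0.
by move: b0; rewrite /xplus; move: (U t) (xminus t0 u0) => Ut xm; lra.
Qed.

(** By the integral equation and the bound on the solution, the function is Lipschitz with respect
    to the derivator, with constant [K]. *)
Lemma explicit_solution_ACg (u0 T : R) : 0 <= t0 ->
  in_ACg T t0 alpha (explicit_solution t0 alpha u0).
Proof.
move=> t0_ge0 e e0; pose U := explicit_solution t0 alpha u0.
pose K : R := (`|u0| + `|xplus t0 alpha u0|) ^+ 3.
have K0 : 0 <= K by rewrite exprn_ge0// addr_ge0.
exists (e / (K + 1)); first by rewrite divr_gt0// ltr_wpDl.
move=> n a b ab abT _ small.
have incr (j : 'I_n) : `|U (b j) - U (a j)| <=
    K * (derivator t0 alpha (b j) - derivator t0 alpha (a j)).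
  have a0 : 0 <= a j.
    have /= := abT j (a j); rewrite !in_itv/= lexx ab => /(_ isT).
    by case/andP.
  have ajb := ltW (ab j); have b0 := le_trans a0 ajb.
  have iU := integrable_explicit_solution u0 3 b0.
  rewrite /U (explicit_solution_integral_eq u0 t0_ge0 b0).
  rewrite (explicit_solution_integral_eq u0 t0_ge0 a0).
  rewrite (Rintegral_itv_incr iU a0 ajb (lexx _)).
  have alg (p q : R) : u0 - (p + q) - (u0 - p) = - q by ring.
  rewrite alg normrN; apply: (Rintegral_itv_bound ajb) => //.
    by apply: integrable_subitv iU.
  apply: aeW => s; rewrite in_itv/= => /andP[as_ _]; rewrite normrX ler_pow3//.
  by apply: norm_explicit_solution_le; exact: le_trans as_.
apply: (@le_lt_trans _ _ (\sum_(j < n)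
    K * (derivator t0 alpha (b j) - derivator t0 alpha (a j)))).
  by apply: ler_sum => j _.
rewrite -mulr_sumr.
have sum0 : 0 <= \sum_(j < n)
    (derivator t0 alpha (b j) - derivator t0 alpha (a j)).
  apply: sumr_ge0 => j _; rewrite -lee_fin -mu_g_itv; first exact: measure_ge0.
  exact: ltW.
move: small; rewrite ltr_pdivlMr ?ltr_wpDl// => small.
by apply: le_lt_trans small; rewrite mulrC ler_wpM2l// lerDl.
Qed.

End explicit_solution.

(** * From weak solutions to the integral equation *)

Section weak_to_integral.
Context (R : realType) (t0 : R) (alpha : {posnum R}).
Notation mu := (mu_g t0 alpha).
Notation carT := (caratheodory_type (mu_ext (borel_mu t0 alpha))).

Lemma weak_solution_primitive (T u0 : R) (v : R -> R) (vT : R) :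
  0 <= t0 -> t0 < T -> weak_solution T t0 alpha u0 v vT ->
  let V := fun t : R => u0 - \int[mu]_(s in `[0, t[) (v s ^+ 3) in
  {ae mu, forall t, t \in `[0, T[ -> v t = V t} /\ vT = V T.
Proof.
move=> t0_ge0 t0T [/in_Lg1P iv /in_Lg1P iv3 weak] V.
have T0 : 0 <= T := ltW (le_lt_trans t0_ge0 t0T).
have mD := measurable_itv_mu_g t0 alpha `[0, T[.
have V0 : V 0 = u0.
  by rewrite /V (Rintegral_itvxx t0 alpha 0 (fun s => v s ^+ 3)) subr0.
have mv : measurable_fun (`[0, T[ : set carT) v.
  exact/measurable_EFinP/(measurable_int _ iv).
have mV : measurable_fun (`[0, T[ : set carT) V.
  exact: (measurable_funB (measurable_cst u0) (measurable_primitive T0 iv3)).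
(* Integration by parts for [V] with [f] the cube of [v] has the same [Sg] term and the same term at
   0 as the weak identity for [v]; both cancel on subtraction. *)
have key (c K : R) (psi : R -> R) : measurable_fun (`[0, T[ : set carT) psi ->
    0 <= K -> (forall s, s \in `[0, T[ -> `|psi s| <= K) ->
    mu.-integrable `[0, T[ (EFin \o (fun s => V s * psi s)) /\
    \int[mu]_(s in `[0, T[) (v s * psi s) - \int[mu]_(s in `[0, T[) (V s * psi s)
    = (vT - V T) * test_fun t0 alpha c psi T.
  move=> mpsi K0 psiK.
  have aepsiK : {ae mu, forall s, s \in `[0, T[ -> `|psi s| <= K} by exact: aeW.
  have Lpsi : in_Lg T t0 alpha +oo%E psi.
    by apply/in_LgyP; split => //; exists K.
  have VE (t : R) : 0 <= t -> t <= T ->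
    V t = u0 - \int[mu]_(s in `[0, t[) (v s ^+ 3) by [].
  have [iVpsi _] := mu_g_integration_by_parts c t0_ge0 t0T iv3 VE mpsi K0 aepsiK.
  have := weak c psi Lpsi; rewrite V0 /=.
  set p := test_fun t0 alpha c psi.
  have alg (x y z m n k l q : R) :
      x - y = m * n - k -> z - y = q * n - k -> x - z = (m - q) * n.
    by move=> e1 e2; have -> : x - z = (x - y) - (z - y);
      [ring|rewrite e1 e2; ring].
  by move=> e1 e2; split=> //; apply: alg e1 e2.
have vTE : vT = V T.
  (* Here [c = 1] and [psi = 0], so the test function is constantly 1 and only [vT - V T]
     survives. *)
  have [|_] := key 1 0 (fun=> 0) (measurable_cst _) (lexx _).
    by move=> s _; rewrite normr0.
  have zE (D : set carT) : measurable D -> \int[mu]_(s in D) (0 : R) = 0.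
    by move=> mD'; rewrite (Rintegral_cst mu mD' 0) mul0r.
  under eq_Rintegral do rewrite mulr0.
  under [X in _ - X]eq_Rintegral do rewrite mulr0.
  rewrite /test_fun !zE//.
  by rewrite subrr addr0 mulr1 => /esym/eqP; rewrite subr_eq0 => /eqP.
split=> //.
(* With this sign, [(v - V) * psi] is the absolute value of [v - V]; its integral vanishes because
   [vT = V T]. *)
pose psi (s : R) : R := if V s <= v s then 1 else -1.
have mpsi : measurable_fun (`[0, T[ : set carT) psi.
  exact: (measurable_fun_if mD (measurable_fun_ler mV mv)
    (measurable_cst _) (measurable_cst _)).
have psi1 (s : R) : s \in `[0, T[ -> `|psi s| <= 1.
  by move=> _; rewrite /psi; case: ifP; rewrite ?normrN normr1.
have [iVpsi] := key 0 1 psi mpsi ler01 psi1.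
rewrite vTE subrr mul0r.
have ivpsi : mu.-integrable `[0, T[ (EFin \o (fun s => v s * psi s)).
  have -> : EFin \o (fun s => v s * psi s) = EFin \o (fun s => psi s * v s).
    by apply/funext => s /=; rewrite mulrC.
  exact: (integrable_mul_bounded mD mpsi psi1 iv).
have := @RintegralB _ _ _ mu `[0, T[%classic (fun s => v s * psi s)
  (fun s => V s * psi s) mD ivpsi iVpsi.
move=> <-.
have dE : (fun s : R => v s * psi s - V s * psi s) = (fun s => `|v s - V s|).
  apply/funext => s; rewrite -mulrBl /psi; case: leP => h.
    by rewrite mulr1 ger0_norm// subr_ge0.
  by rewrite mulrN1 ltr0_norm// subr_lt0.
have id : mu.-integrable `[0, T[ (EFin \o (fun s => `|v s - V s|)).
  by rewrite -dE; exact: (integrableB mD ivpsi iVpsi).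
rewrite dE => int0.
have fin := integrable_fin_num mD id.
have abs0 : (\int[mu]_(s in `[0%R, T[) `|(v s - V s)%:E| = 0)%E.
  by rewrite -[LHS](fineK fin); congr EFin; exact: int0.
have mdE : measurable_fun (`[0, T[ : set carT) (EFin \o (fun s => v s - V s)).
  by apply/measurable_EFinP; exact: measurable_funB.
have := (ae_eq_integral_abs mu mD mdE).1 abs0.
apply: negligibleS; apply: subsetC => s /= h sT.
by have [] := h sT => /eqP; rewrite subr_eq0 => /eqP.
Qed.

End weak_to_integral.

(** * Existence and uniqueness in the integral and in the weak sense *)

Theorem theorem7p2 (R : realType) (T t0 u0 : R) (alpha : {posnum R})
    (T_gt0 : 0 < T) (t0_in : t0 \in `]0, T[) :
  let U := explicit_solution t0 alpha u0 in
  [/\ integral_solution T t0 alpha u0 U,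
      forall V : R -> R, integral_solution T t0 alpha u0 V ->
        {in `[0, T], V =1 U},
      weak_solution T t0 alpha u0 U (U T) &
      forall (v : R -> R) (vT : R), weak_solution T t0 alpha u0 v vT ->
        {ae mu_g t0 alpha, forall t, t \in `[0, T[ -> v t = U t} /\ vT = U T].
Proof.
move=> U.
move: t0_in; rewrite in_itv/= => /andP[t0_gt0 t0T].
have t0_ge0 := ltW t0_gt0; have T0 := ltW T_gt0.
have iU n := @integrable_explicit_solution R t0 alpha u0 T n T0.
have UE (t : R) : 0 <= t -> t <= T ->
    U t = u0 - \int[mu_g t0 alpha]_(s in `[0, t[) (U s ^+ 3).
  by move=> t_ge0 _; exact: explicit_solution_integral_eq.
have U0 : U 0 = u0 by rewrite /U explicit_solutionE t0_ge0 cubic_flow0.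
split.
- split; [exact: explicit_solution_ACg|exact/in_Lg1P/iU|].
  by move=> t; rewrite in_itv/= => /andP[t_ge0 tT]; exact: UE.
- move=> V [_ /in_Lg1P iV VE] t; rewrite in_itv/= => /andP[t_ge0 tT].
  apply: (integral_eq_unique t0_ge0 (ltW t0T) iV (iU 3) _ UE) => // s s0 sT.
  by apply: VE; rewrite in_itv/= s0.
- split; [exact/in_Lg1P/(iU 1)|exact/in_Lg1P/(iU 3)|].
  move=> c psi /in_LgyP[mpsi [K K0 psiK]] phi.
  have [_ _] := mu_g_integration_by_parts c t0_ge0 t0T (iU 3) UE mpsi K0 psiK.
  by rewrite U0.
- move=> v vT vsol; have [/in_Lg1P iv /in_Lg1P iv3 _] := vsol.
  have [vV vTE] := weak_solution_primitive t0_ge0 t0T vsol.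
  pose V (t : R) : R := u0 - \int[mu_g t0 alpha]_(s in `[0, t[) (v s ^+ 3).
  have mV := measurable_funB (measurable_cst u0) (measurable_primitive T0 iv3).
  pose B : R := `|u0| + \int[mu_g t0 alpha]_(x in `[0, T[) `|v x ^+ 3|.
  have iV3 : (mu_g t0 alpha).-integrable `[0, T[ (EFin \o (fun s => V s ^+ 3)).
    apply: (bounded_integrable_itv (K := B ^+ 3) T0).
      exact: measurable_funX mV.
    move=> s; rewrite in_itv/= => /andP[s0 sT]; rewrite normrX ler_pow3//.
    apply: (le_trans (ler_normB _ _)); rewrite lerD2l.
    by apply: (le_norm_Rintegral_itv iv3) => //; exact: ltW.
  (* Since [v = V] almost everywhere, [v ^+ 3] may be replaced by [V ^+ 3] in the definition of [V],
     which turns it into the integral equation for [V] at every point. *)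
  have VE (t : R) : 0 <= t -> t <= T ->
      V t = u0 - \int[mu_g t0 alpha]_(s in `[0, t[) (V s ^+ 3).
    move=> t_ge0 tT; congr (_ - fine _).
    apply: ae_eq_integral; first exact: measurable_itv_mu_g.
    - exact: (measurable_int _ (integrable_subitv (lexx 0) tT iv3)).
    - exact: (measurable_int _ (integrable_subitv (lexx 0) tT iV3)).
    apply: negligibleS vV; apply: subsetC => s /= vVs; rewrite in_itv/= => /andP[s0 st].
    by rewrite vVs// in_itv/= s0 (lt_le_trans st).
  have VU := integral_eq_unique t0_ge0 (ltW t0T) iV3 (iU 3) VE UE.
  split; last by rewrite vTE; exact: (VU T T0 (lexx T)).
  apply: negligibleS vV; apply: subsetC => s /= vVs sT; rewrite (vVs sT).
  by move: sT; rewrite in_itv/= => /andP[s0 /ltW sT]; exact: VU.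
Qed.
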